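(* Let $G$ be a directed graph. (1) The following are equivalent: (a) $P(G)$ is a projective variety (i.e. an irreducible projective algebraic set); (b) $P(G)$ is a linear subspace of $\mathbb{CP}^{|E(G)|-1}$; (c) $G$ contains exactly $\alpha(G)$ distinct directed cycles. (2) The following are equivalent: (a) $\tilde P(G)$ is a projective variety; (b) $\tilde P(G)$ is a linear subspace of $\mathbb{CP}^{|E(G)|-1}$; (c) $G$ contains exactly $\tilde\alpha(G)$ distinct directed cycles. (3) If $\tilde P(G)$ is a projective variety, then $P(G)=\tilde P(G)$.
   Context: A directed graph $G$ is a pair of finite sets $V(G)$, $E(G)$, each edge having an initial and a terminal vertex; loops and multiple edges allowed, no vertex of degree $0$. Directed cycles: sequences $v_0,x_0,\dots,v_n,x_n,v_0$ with distinct vertices and $x_i$ from $v_i$ to $v_{i+1}$, up to circular permutation. $\alpha(G)$ (resp. $\tilde\alpha(G)$) is the maximal number of pairwise edge-disjoint (resp. vertex-disjoint) directed cycles in $G$. For a vertex $v$ with outgoing edges $x_1,\dots,x_m$ and incoming edges $y_1,\dots,y_n$ (loops counted in both lists), let $k_v=\max\{m,n\}$ and $\delta_{v,l}=e_l(x_1,\dots,x_m)-e_l(y_1,\dots,y_n)$ for $1\le l\le k_v$ ($e_l$ elementary symmetric polynomials). $I(G)\subset\mathbb{Z}[E(G)]$ is the ideal generated by all $\delta_{v,l}$ and $P(G)$ its zero set in $\mathbb{CP}^{|E(G)|-1}$ (coordinates indexed by $E(G)$). The strong incidence ideal $\tilde I(G)$ is generated by, for every vertex $v$, $e_1(x_1,\dots,x_m)-e_1(y_1,\dots,y_n)$,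 $e_l(x_1,\dots,x_m)$ for $2\le l\le m$, and $e_l(y_1,\dots,y_n)$ for $2\le l\le n$; $\tilde P(G)$ is its zero set in $\mathbb{CP}^{|E(G)|-1}$. *)

(* Defs.v *)
From HB Require Import structures.
From mathcomp Require Import all_boot all_order all_algebra.
From mathcomp Require Import classical_sets reals complex mpoly.

Set Implicit Arguments.
Unset Strict Implicit.
Unset Printing Implicit Defensive.

Import GRing.Theory.
Local Open Scope ring_scope.

(* Loops and multiple edges are allowed; vertices of degree 0 are not. *)
Record digraph := Digraph {
  vertex : finType;
  edge : finType;
  src : edge -> vertex;
  tgt : edge -> vertex;
  no_isolated : forall v : vertex, exists e : edge, (src e == v) || (tgt e == v)
}.

Section DirectedCycles.
Variable G : digraph.

(* A sequence v_0, x_0, ..., v_n, x_n, v_0 is encoded by its edges x_0, ..., x_n,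
   since v_i = src x_i.  As the v_i are distinct, its length is at most the
   number of vertices, so bounded sequences suffice. *)
Definition cycle_seq : finType := #|vertex G|.-bseq (edge G).

Definition is_dicycle (s : cycle_seq) : bool :=
  [&& s != [::] :> seq (edge G),
      cycle (fun x y => tgt x == src y) s
    & uniq [seq src x | x <- s]].

Definition rot_eq : rel cycle_seq :=
  fun s t => [exists i : 'I_(size s).+1, t == rot i s :> seq (edge G)].

(* A directed cycle is a class of such sequences up to circular permutation. *)
Definition dicycles : {set {set cycle_seq}} :=
  equivalence_partition rot_eq [set s | is_dicycle s].

Definition dicycle_edges (c : {set cycle_seq}) : {set edge G} :=
  [set x | [exists s in c, x \in val s]].

Definition dicycle_vertices (c : {set cycle_seq}) : {set vertex G} :=
  [set v | [exists s in c, v \in [seq src x | x <- val s]]].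

Definition edge_disjoint (F : {set {set cycle_seq}}) : bool :=
  [forall c in F, forall d in F,
    (c != d) ==> [disjoint dicycle_edges c & dicycle_edges d]].

Definition vertex_disjoint (F : {set {set cycle_seq}}) : bool :=
  [forall c in F, forall d in F,
    (c != d) ==> [disjoint dicycle_vertices c & dicycle_vertices d]].

Definition alpha : nat :=
  (\max_(F : {set {set cycle_seq}} | (F \subset dicycles) && edge_disjoint F)
    #|F|)%N.

Definition alpha_strong : nat :=
  (\max_(F : {set {set cycle_seq}} | (F \subset dicycles) && vertex_disjoint F)
    #|F|)%N.

End DirectedCycles.

Section Ideals.
Variable G : digraph.

(* Z[E(G)]; the variable of the edge x is 'X_(enum_rank x). *)
Definition edge_poly := {mpoly int[#|edge G|]}.

Definition out_edges (v : vertex G) : {set edge G} := [set x | src x == v].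
Definition in_edges (v : vertex G) : {set edge G} := [set x | tgt x == v].

(* The l-th elementary symmetric polynomial in the variables of A. *)
Definition elem_sym (A : {set edge G}) (l : nat) : edge_poly :=
  mesym #|A| int l \mPo [tuple 'X_(enum_rank (enum_val i)) | i < #|A|].

Definition delta (v : vertex G) (l : nat) : edge_poly :=
  elem_sym (out_edges v) l - elem_sym (in_edges v) l.

Definition ideal_gen (S : set edge_poly) : set edge_poly :=
  [set f | exists s : seq (edge_poly * edge_poly),
     (forall x, x \in s -> S x.2) /\ f = \sum_(x <- s) x.1 * x.2].

Definition incidence_gens : set edge_poly :=
  [set f | exists v l,
     (1 <= l <= maxn #|out_edges v| #|in_edges v|)%N /\ f = delta v l].

Definition strong_incidence_gens : set edge_poly :=
  [set f | exists v : vertex G,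
     [\/ f = elem_sym (out_edges v) 1 - elem_sym (in_edges v) 1,
         exists l, (2 <= l <= #|out_edges v|)%N /\ f = elem_sym (out_edges v) l
       | exists l, (2 <= l <= #|in_edges v|)%N /\ f = elem_sym (in_edges v) l]].

Definition incidence_ideal : set edge_poly := ideal_gen incidence_gens.

Definition strong_incidence_ideal : set edge_poly :=
  ideal_gen strong_incidence_gens.

End Ideals.

Section ProjectiveSpace.
Variables (F : fieldType) (n : nat).

(* The projective space P^(n-1) of lines through the origin of F^n. *)
Definition proj_space := {L : {vspace 'rV[F]_n} | \dim L == 1%N}.

(* f vanishes at every choice of homogeneous coordinates of the point L. *)
Definition vanishes_at (f : {mpoly F[n]}) (L : proj_space) : Prop :=
  forall u : 'rV[F]_n, u \in val L -> u != 0 -> f.@[fun i => u 0 i] = 0.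

Definition zero_locus (S : set {mpoly F[n]}) : set proj_space :=
  [set L | forall f, S f -> vanishes_at f L].

Definition algebraic_set (X : set proj_space) : Prop :=
  exists S : set {mpoly F[n]},
    (forall f, S f -> exists d, f \is d.-homog) /\ X = zero_locus S.

(* Irreducible: not the union of two proper algebraic subsets.  With this
   convention the empty set is a projective variety. *)
Definition projective_variety (X : set proj_space) : Prop :=
  algebraic_set X /\
  forall A B : set proj_space, algebraic_set A -> algebraic_set B ->
    X = (A `|` B)%classic -> X = A \/ X = B.

(* The empty set is the linear subspace given by W = 0. *)
Definition linear_subspace (X : set proj_space) : Prop :=
  exists W : {vspace 'rV[F]_n}, X = [set L | (val L <= W)%VS]%classic.

End ProjectiveSpace.

Section IncidenceVarieties.
Variables (R : realType) (G : digraph).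

Definition int_zero_locus (I : set (edge_poly G)) :
    set (proj_space R[i] #|edge G|) :=
  zero_locus [set map_mpoly intr f | f in I]%classic.

Definition incidence_variety : set (proj_space R[i] #|edge G|) :=
  int_zero_locus (incidence_ideal (G := G)).

Definition strong_incidence_variety : set (proj_space R[i] #|edge G|) :=
  int_zero_locus (strong_incidence_ideal (G := G)).

End IncidenceVarieties.

Arguments incidence_variety R G : clear implicits.
Arguments strong_incidence_variety R G : clear implicits.

(* Main.v *)
Require Import Defs.
From mathcomp Require Import all_boot all_order all_algebra.
From mathcomp Require Import classical_sets reals complex mpoly.
From mathcomp Require Import fintype finset.

(* By unique factorization of the polynomials prod (T - x), the equations at a
   vertex v say that the outgoing and the incoming edges carry the same nonzero
   values with the same multiplicities.  Hence for each nonzero value the edges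
   carrying it form an Eulerian subgraph, and peeling off directed cycles shows
   that the cone over P(G) is the union, over the edge-disjoint families C of
   directed cycles, of the spans of the indicator vectors of the members of C.
   The additional strong equations allow at most one nonzero outgoing and one
   nonzero incoming edge at each vertex, which turns edge-disjoint families into
   vertex-disjoint ones.  An irreducible finite union of linear subspaces is one of
   them, and the indicator vector of a cycle lies in the span of an edge-disjoint
   family only if the cycle is a member.  So irreducibility forces the family of
   all directed cycles to be disjoint, in which case the union is its span. *)

Set Implicit Arguments.
Unset Strict Implicit.
Unset Printing Implicit Defensive.

Import Order.TTheory GRing.Theory Num.Theory.
Local Open Scope ring_scope.

(** * Directed cycles *)

Lemma uniq_map_inj (T1 T2 : eqType) (f : T1 -> T2) (s : seq T1) :
  uniq [seq f x | x <- s] -> {in s &, injective f}.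
Proof.
move=> us x y xs ys fxy; have x0 := x.
rewrite -(nth_index x0 xs) -(nth_index x0 ys); congr nth; apply/eqP.
rewrite -(nth_uniq (f x0) _ _ us) ?size_map ?index_mem //.
by rewrite !(nth_map x0) ?index_mem // !nth_index // fxy.
Qed.

Lemma rot_rot_ex (T : Type) i j (s : seq T) :
  exists k, rot j (rot i s) = rot k s.
Proof.
have [le_is|/ltnW/rot_oversize->] := leqP i (size s); last by exists j.
have [le_js|lt_sj] := leqP j (size s); last first.
  by exists i; rewrite rot_oversize // size_rot ltnW.
by rewrite rot_add_mod //; eexists.
Qed.

Section DirectedCycleLemmas.
Variable G : digraph.
Implicit Types (s t : cycle_seq G) (c d : {set cycle_seq G}) (v : vertex G).

Lemma rot_eqP s t :
  reflect (exists i, val t = rot i (val s)) (rot_eq s t).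
Proof.
apply: (iffP existsP) => [[i /eqP e]|[i e]]; first by exists i.
have [le_is|lt_si] := leqP i (size s).
  by exists (Ordinal (le_is : (i < (size s).+1)%N)); apply/eqP.
(* A rotation index beyond the size acts as the identity, just as index 0 does. *)
by exists ord0; rewrite rot0 -(rot_oversize (ltnW lt_si)); apply/eqP.
Qed.

Lemma rot_eq_refl s : rot_eq s s.
Proof. by apply/rot_eqP; exists 0; rewrite rot0. Qed.

Lemma rot_eq_sym s t : rot_eq s t -> rot_eq t s.
Proof.
move/rot_eqP=> [i e]; apply/rot_eqP; exists (size (val t) - i)%N.
by rewrite -/(rotr i (val t)) e rotK.
Qed.

Lemma rot_eq_trans s t u : rot_eq s t -> rot_eq t u -> rot_eq s u.
Proof.
move=> /rot_eqP[i et] /rot_eqP[j eu]; apply/rot_eqP.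
by rewrite eu et; apply: rot_rot_ex.
Qed.

Definition rot_class s : {set cycle_seq G} :=
  [set t in [set s | is_dicycle s] | rot_eq s t].

Lemma dicyclesP c :
  reflect (exists2 s, is_dicycle s & c = rot_class s) (c \in dicycles G).
Proof.
apply: (iffP imsetP) => [[s]|[s sP ->]].
  by rewrite inE => sP ->; exists s.
by exists s; rewrite ?inE.
Qed.

Lemma mem_rot_class s : is_dicycle s -> s \in rot_class s.
Proof. by move=> sP; rewrite !inE sP rot_eq_refl. Qed.

Lemma rot_class_mem s t x : t \in rot_class s -> (x \in val t) = (x \in val s).
Proof. by rewrite inE => /andP[_ /rot_eqP[i ->]]; rewrite mem_rot. Qed.

Lemma rot_class_edges s : is_dicycle s ->
  dicycle_edges (rot_class s) = [set x in val s].
Proof.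
move=> sP; apply/setP => x; rewrite !inE; apply/existsP/idP.
  by case=> t /andP[/rot_class_mem->].
by move=> xs; exists s; rewrite mem_rot_class.
Qed.

Lemma rot_class_vertices s : is_dicycle s ->
  dicycle_vertices (rot_class s) = [set v in [seq src x | x <- val s]].
Proof.
move=> sP; apply/setP => v; rewrite !inE; apply/existsP/idP.
  case=> t /andP[ts /mapP[x]]; rewrite (rot_class_mem _ ts) => xs ->.
  exact: map_f.
by move=> xs; exists s; rewrite mem_rot_class.
Qed.

Lemma eq_rot_class s t : rot_eq s t -> rot_class s = rot_class t.
Proof.
move=> st; apply/setP => u; rewrite !inE; congr (_ && _).
apply/idP/idP; last exact: rot_eq_trans.
exact/rot_eq_trans/rot_eq_sym.
Qed.

(** Each edge ends where the next one starts, so the targets are the sources shifted by one place.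
    This transfers distinctness of the sources to the targets. *)
Lemma dicycle_tgt s : is_dicycle s ->
  [seq tgt x | x <- val s] = rot 1 [seq src x | x <- val s].
Proof.
case: s => -[|x p] sz /and3P[] //=; rewrite rot1_cons => _ cyc _.
have path_tgt (y : edge G) q : path (fun x y => tgt x == src y) y q ->
    [seq tgt x | x <- belast y q] = [seq src x | x <- q].
  by elim: q y => //= z q IH y /andP[/eqP-> /IH ->].
by by have := path_tgt _ _ cyc; rewrite belast_rcons map_rcons.
Qed.

(** The sources along a cycle are distinct, so counting edges of [c] that leave [v] counts [v] in a
    duplicate-free list. *)
Lemma dicycle_out_degree c v : c \in dicycles G ->
  #|dicycle_edges c :&: out_edges v| = (v \in dicycle_vertices c).
Proof.
case/dicyclesP=> s sP ->; rewrite rot_class_edges // rot_class_vertices // inE.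
have /and3P[_ _ us] := sP; rewrite -(count_uniq_mem _ us) count_map.
rewrite -size_filter -(card_uniqP (filter_uniq _ (map_uniq us))).
by apply: eq_card => x; rewrite !inE mem_filter andbC.
Qed.

Lemma dicycle_in_degree c v : c \in dicycles G ->
  #|dicycle_edges c :&: in_edges v| = (v \in dicycle_vertices c).
Proof.
case/dicyclesP=> s sP ->; rewrite rot_class_edges // rot_class_vertices // inE.
have /and3P[_ _ us] := sP.
have ut : uniq [seq tgt x | x <- val s] by rewrite dicycle_tgt // rot_uniq.
have -> : (v \in [seq src x | x <- val s]) = (v \in [seq tgt x | x <- val s]).
  by rewrite dicycle_tgt // mem_rot.
rewrite -(count_uniq_mem _ ut) count_map.
rewrite -size_filter -(card_uniqP (filter_uniq _ (map_uniq us))).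
by apply: eq_card => x; rewrite !inE mem_filter andbC.
Qed.

Lemma dicycle_edges_neq0 c : c \in dicycles G -> dicycle_edges c != set0.
Proof.
case/dicyclesP=> s sP ->; rewrite rot_class_edges //.
case: s sP => -[|x p] sz /and3P[] //= _ _ _.
by apply/set0Pn; exists x; rewrite inE mem_head.
Qed.

(* Both cycles are orbits of the successor function of the larger one. *)
Lemma dicycle_edges_sub c d : c \in dicycles G -> d \in dicycles G ->
  dicycle_edges c \subset dicycle_edges d -> c = d.
Proof.
move=> /dicyclesP[s sP ->] /dicyclesP[t tP ->]; rewrite !rot_class_edges //.
move=> /subsetP sub; apply: eq_rot_class.
have {}sub x : x \in val s -> x \in val t.
  by move=> xs; have := sub x; rewrite !inE; apply.
have /and3P[s0 cs us] := sP; have /and3P[_ ct ut] := tP.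
have nxt : fcycle (next (val t)) (val s).
  (* The successor of [x] in [t] and the edge [y] start at the same vertex, and the initial vertices
     along [t] are distinct. *)
  have sub_next : {in mem (val s) &,
      subrel (fun x y => tgt x == src y) (frel (next (val t)))}.
    move=> x y xs ys /eqP exy /=.
    have xt := sub _ xs; have yt := sub _ ys.
    have /eqP e := next_cycle ct xt.
    by apply/eqP/(uniq_map_inj ut); rewrite ?mem_next // -e exy.
  by apply: (sub_in_cycle sub_next) cs; apply/allP.
have [x xs] : exists x, x \in val s.
  by move: s0; rewrite -size_eq0 -lt0n -has_predT => /hasP[x xs _]; exists x.
have [i ei] := orbit_rot_cycle nxt (map_uniq us) xs.
have [j] := orbit_rot_cycle (cycle_next (map_uniq ut)) (map_uniq ut) (sub _ xs).
rewrite ei => e; apply/rot_eqP.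
have [k ek] := rot_rot_ex i (size (val t) - j) (val s).
by exists k; rewrite -ek e -(size_rot j) -/(rotr j _) rotK.
Qed.

(** Following a fixed choice of successors inside the finite set [A] must eventually run into a
    cycle. *)
Lemma exists_dicycle_in (A : {set edge G}) : A != set0 ->
  (forall x, x \in A -> exists2 y, y \in A & src y = tgt x) ->
  exists2 c, c \in dicycles G & dicycle_edges c \subset A.
Proof.
case/set0Pn=> x0 x0A nxt.
(* The successor of an edge is a function of its terminal vertex alone. Hence edges of the orbit
   with the same source coincide, which gives distinct vertices. The default [x0] never occurs for
   edges of [A]. *)
pose g v := odflt x0 [pick y in A | src y == v].
pose h x := g (tgt x).
have hP x : x \in A -> (h x \in A) && (src (h x) == tgt x).
  move=> xA; rewrite /h /g; case: pickP => //= no.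
  by have [y yA /eqP e] := nxt x xA; have := no y; rewrite yA e.
(* If the orbit of [x] did not close up, [h x] would have a strictly shorter orbit, so minimality
   puts [x] on a cycle of [h]. *)
have [x xA xmin] := @arg_minnP _ x0 (fun x => x \in A) (order h) x0A.
have cyc : fcycle h (orbit h x).
  case: (orderPcycle h x) => // _ e.
  by have /andP[/xmin + _] := hP x xA; rewrite e ltnn.
have iterA k : iter k h x \in A by elim: k => //= k /hP /andP[].
have orbA y : y \in orbit h x -> y \in A.
  by rewrite -fconnect_orbit => /iter_findex <-.
have orb_h y : y \in orbit h x -> exists2 z, z \in A & y = h z.
  rewrite -fconnect_orbit => /iter_findex <-.
  case: (findex h x y) => [|k]; last by exists (iter k h x).
  have e : iter (order h x) h x = x by apply: (orbitPcycle 0 4).1 cyc.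
  by exists (iter (order h x).-1 h x); rewrite // -iterS orderSpred e.
have src_inj : {in orbit h x &, injective (@src G)}.
  move=> y z /orb_h[y' y'A ->] /orb_h[z' z'A ->].
  have /andP[_ /eqP->] := hP _ y'A; have /andP[_ /eqP->] := hP _ z'A.
  by rewrite /h => ->.
have us : uniq [seq src y | y <- orbit h x] by rewrite map_inj_in_uniq ?orbit_uniq.
have sz : (size (orbit h x) <= #|vertex G|)%N.
  by rewrite -(size_map (@src G)) -(card_uniqP us) max_card.
pose s : cycle_seq G := Bseq sz.
have sP : is_dicycle s.
  apply/and3P; split => //=; first by rewrite -size_eq0 size_orbit -orderSpred.
  have sub_e : {in mem A &, subrel (frel h) (fun x y => tgt x == src y)}.
    by move=> y z yA _ /= /eqP<-; have /andP[_ /eqP->] := hP y yA.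
  by apply: (sub_in_cycle sub_e) cyc; apply/allP.
exists (rot_class s); first by apply/dicyclesP; exists s.
by rewrite rot_class_edges //; apply/subsetP => y; rewrite inE => /orbA.
Qed.

End DirectedCycleLemmas.

(** * Elementary symmetric polynomials and multiplicities of values *)

Section ElementarySymmetric.
Variables (F : fieldType) (T : finType).
Implicit Types (A B : {set T}) (w : T -> F) (l : nat).

Definition esym_at A w l : F := (mesym #|A| F l).@[fun i => w (enum_val i)].

Lemma esym_at0 A w : esym_at A w 0 = 1.
Proof. by rewrite /esym_at mesym0E meval1. Qed.

Lemma esym_at_geq A w l : (#|A| < l)%N -> esym_at A w l = 0.
Proof. by move=> lt_A; rewrite /esym_at mesym_geqnE ?meval0. Qed.

(** Vieta's formulas. *)
Lemma prod_XsubC_coef A w k : (k <= #|A|)%N ->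
  (\prod_(x in A) ('X - (w x)%:P))`_(#|A| - k) = (-1) ^+ k * esym_at A w k.
Proof.
rewrite -ltnS => le_kA; pose cs := [tuple w (enum_val i) | i < #|A|].
have <- : \prod_(c <- cs) ('X - c%:P) = \prod_(x in A) ('X - (w x)%:P).
  by rewrite big_map big_enum [RHS]big_enum_val.
rewrite (mroots_coeff cs (Ordinal le_kA)); congr (_ * _).
by apply: meval_eq => i; rewrite tnth_mktuple.
Qed.

(** The factor ['X^n] serves to bring products over sets of different sizes to a common degree. For
    [i < n] the coefficient is 0, and so is [esym_at], whose index then exceeds [#|A|]. *)
Lemma prodXn_coef A w n i : (i <= n + #|A|)%N ->
  ('X^n * \prod_(x in A) ('X - (w x)%:P))`_i =
    (-1) ^+ (n + #|A| - i) * esym_at A w (n + #|A| - i).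
Proof.
move=> le_i; rewrite coefXnM; case: ltnP => [lt_in|le_ni].
  rewrite esym_at_geq ?mulr0 // addnC -addnBA ?(ltnW lt_in) //.
  by rewrite -[X in (X < _)%N]addn0 ltn_add2l subn_gt0.
rewrite -prod_XsubC_coef; last by rewrite leq_subLR leq_add2r.
by congr (_`_ _); rewrite -[in RHS](subnKC le_ni) subnDl subKn // leq_subLR.
Qed.

(** Both polynomials have degree [#|A| + #|B|], so corresponding coefficients are elementary
    symmetric values of the same index with the same sign. Beyond that index both values vanish. *)
Lemma prodXn_esym_eq A B w :
  ('X^#|B| * \prod_(x in A) ('X - (w x)%:P) =
   'X^#|A| * \prod_(x in B) ('X - (w x)%:P))
  <-> (forall l, esym_at A w l = esym_at B w l).
Proof.
split=> [e l|e].
  have [lt_l|le_l] := ltnP (#|B| + #|A|) l.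
    rewrite !esym_at_geq //; apply: leq_ltn_trans lt_l.
    - exact: leq_addr.
    - exact: leq_addl.
  have := congr1 (fun p : {poly F} => p`_(#|B| + #|A| - l)) e.
  rewrite !prodXn_coef ?leq_subr //; last by rewrite [X in (_ <= X)%N]addnC leq_subr.
  rewrite [X in _ = _ ^+ (X - _) * _]addnC [X in _ = _ * esym_at _ _ (X - _)]addnC.
  by rewrite subKn // => /(can_inj (signrMK _)).
apply/polyP => i; have [le_i|lt_i] := leqP i (#|B| + #|A|).
  by rewrite !prodXn_coef ?e // 1?addnC // [(#|A| + _)%N]addnC.
have sz (C : {set T}) n : size ('X^n * \prod_(x in C) ('X - (w x)%:P)) = (n + #|C|).+1.
  have -> : \prod_(x in C) ('X - (w x)%:P) =
      \prod_(c <- [seq w x | x <- enum C]) ('X - c%:P) by rewrite big_map big_enum.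
  rewrite mulrC size_mulXn -?size_poly_gt0 ?size_prod_XsubC //.
  by rewrite size_map -cardE addnS.
by rewrite !nth_default ?sz // addnC.
Qed.

Definition level A w (a : F) : {set T} := [set x in A | w x == a].

Lemma card_level A w a : #|level A w a| = count_mem a [seq w x | x <- enum A].
Proof.
rewrite count_map -size_filter cardE /enum_mem -filter_predI.
by congr size; apply: eq_filter => x; rewrite !inE andbC.
Qed.

(** Equal products of monic linear factors have the same roots with multiplicities. Only the root 0
    is affected by the padding with powers of ['X]. *)
Lemma esym_level_eq A B w :
  (forall l, esym_at A w l = esym_at B w l) <->
  (forall a, a != 0 -> #|level A w a| = #|level B w a|).
Proof.
pose sA := nseq #|B| (0 : F) ++ [seq w x | x <- enum A].
pose sB := nseq #|A| (0 : F) ++ [seq w x | x <- enum B].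
have prod_s (C : {set T}) n : 'X^n * \prod_(x in C) ('X - (w x)%:P) =
    \prod_(c <- nseq n 0 ++ [seq w x | x <- enum C]) ('X - c%:P).
  rewrite big_cat big_map big_enum /=; congr (_ * _).
  by rewrite big_nseq subr0 iter_mulr_1.
have cnt (C : {set T}) n a : a != 0 ->
    count_mem a (nseq n 0 ++ [seq w x | x <- enum C]) = #|level C w a|.
  by move=> a0; rewrite count_cat count_nseq /= eq_sym (negbTE a0) mul0n card_level.
rewrite -prodXn_esym_eq !prod_s -/sA -/sB; split=> [/prod_XsubC_eq/permP pe a a0|lev].
  by rewrite -(cnt A #|B| _ a0) -(cnt B #|A| _ a0); apply: pe.
apply: perm_big; have cnt0 a : a != 0 -> count_mem a sA = count_mem a sB.
  by move=> a0; rewrite /sA /sB !cnt // lev.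
(* The multiplicity of 0 is recovered by subtraction: [sA] and [sB] have the same length and equally
   many nonzero entries. *)
have nz : count (predC1 0) sA = count (predC1 0) sB.
  rewrite -!size_filter; apply: perm_size; apply/allP => a _; apply/eqP.
  rewrite !count_filter; have [->|a0] := eqVneq a 0.
    by rewrite !(@eq_count _ _ pred0) ?count_pred0 // => x /=; case: eqP.
  have eqc : predI (pred1 a) (predC1 0) =1 pred1 a.
    by move=> x /=; case: (x =P a) => // ->.
  by rewrite !(eq_count eqc) cnt0.
apply/allP => a _; apply/eqP; have [->|/cnt0//] := eqVneq a 0.
apply: (@addIn (count (predC1 0) sB)).
rewrite -[in LHS]nz !(count_predC (pred1 0)).
by rewrite !size_cat !size_nseq !size_map -!cardE addnC.
Qed.

Definition nonzeros A w : {set T} := [set x in A | w x != 0].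

(** Discarding zero values leaves the level sets of all nonzero values unchanged. *)
Lemma esym_nonzeros A w l : esym_at A w l = esym_at (nonzeros A w) w l.
Proof.
move: l; apply/esym_level_eq => a a0; congr (#|pred_of_set _|).
by apply/setP => x; rewrite !inE; have [->|_] := eqVneq (w x) a;
   rewrite ?a0 ?andbT ?andbF.
Qed.

Lemma esym_at_card A w : esym_at A w #|A| = \prod_(x in A) w x.
Proof.
rewrite /esym_at mesymnnE rmorph_prod /= [RHS]big_enum_val.
by apply: eq_bigr => i _; rewrite mevalXU.
Qed.

(** If exactly k values are nonzero and k is at least 2, then the k-th elementary symmetric value is
    their product, which is nonzero. *)
Lemma card_nonzeros_le1 A w :
  (forall l, (2 <= l <= #|A|)%N -> esym_at A w l = 0) <->
  (#|nonzeros A w| <= 1)%N.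
Proof.
split=> [e0|le1 l /andP[l2 _]]; last first.
  by rewrite esym_nonzeros esym_at_geq // (leq_ltn_trans le1).
rewrite leqNgt; apply/negP => gt1.
have NA : nonzeros A w \subset A by apply/subsetP => x; rewrite inE => /andP[].
have := e0 #|nonzeros A w|; rewrite gt1 subset_leq_card // => /(_ isT) /eqP.
rewrite esym_nonzeros esym_at_card; apply/negP/prodf_neq0 => x.
by rewrite inE => /andP[].
Qed.

End ElementarySymmetric.

(** * Zeros of the incidence ideals *)

Section Balanced.
Variables (F : fieldType) (G : digraph).
Local Notation point := 'rV[F]_#|edge G|.
Implicit Types (u : point) (A : {set edge G}) (v : vertex G).
Implicit Types (c d : {set cycle_seq G}) (C : {set {set cycle_seq G}}).

Definition edge_coord u (x : edge G) : F := u 0 (enum_rank x).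

Definition eval_at u (f : edge_poly G) : F := (map_mpoly intr f).@[fun i => u 0 i].

Lemma eval_elem_sym u A l :
  eval_at u (elem_sym A l) = esym_at A (edge_coord u) l.
Proof.
rewrite /eval_at /elem_sym /esym_at /mesym [RHS]raddf_sum.
rewrite (raddf_sum (comp_mpoly _)) (raddf_sum (map_mpoly intr)) [LHS]raddf_sum.
apply: eq_bigr => h _ /=; rewrite [RHS]rmorph_prod.
rewrite (rmorph_prod (comp_mpoly _)) (rmorph_prod (map_mpoly intr)) [LHS]rmorph_prod.
apply: eq_bigr => i _; transitivity
  (eval_at u ('X_i \mPo [tuple 'X_(enum_rank (enum_val j)) | j < #|A|])).
  by [].
rewrite /eval_at.
by rewrite comp_mpolyXU -tnth_nth tnth_mktuple map_mpolyX mevalXU [RHS]mevalXU.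
Qed.

Lemma eval_atB u f g : eval_at u (f - g) = eval_at u f - eval_at u g.
Proof. by rewrite /eval_at (rmorphB (map_mpoly intr)) mevalB. Qed.

Lemma eval_ideal_gen u (S : set (edge_poly G)) :
  (forall f, ideal_gen S f -> eval_at u f = 0) <->
  (forall f, S f -> eval_at u f = 0).
Proof.
split=> [S0 f Sf|S0 f [s [Ss ->]]].
  apply: S0; exists [:: (1, f)]; split; last by rewrite big_seq1 mul1r.
  by move=> x; rewrite inE => /eqP->.
rewrite /eval_at (raddf_sum (map_mpoly intr)) [LHS]raddf_sum big_seq big1 // => x xs /=.
by rewrite (rmorphM (map_mpoly intr)) mevalM [X in _ * X](S0 _ (Ss _ xs)) mulr0.
Qed.

Definition balanced u := forall v l,
  esym_at (out_edges v) (edge_coord u) l = esym_at (in_edges v) (edge_coord u) l.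

Lemma balancedP u : balanced u <->
  (forall v a, a != 0 ->
    #|level (out_edges v) (edge_coord u) a| = #|level (in_edges v) (edge_coord u) a|).
Proof. by split=> b v; apply/esym_level_eq/b. Qed.

(** Outside the range of the generators the two sides of [balanced] agree anyway: both are 1 for
    [l = 0], and both are 0 beyond the two degrees. *)
Lemma eval_incidence_ideal u :
  (forall f, incidence_ideal f -> eval_at u f = 0) <-> balanced u.
Proof.
rewrite eval_ideal_gen; split=> [e0 v l|b f [v [l [_ ->]]]]; last first.
  by rewrite /delta eval_atB !eval_elem_sym b subrr.
case: l => [|l]; first by rewrite !esym_at0.
have [lt_l|le_l] := ltnP (maxn #|out_edges v| #|in_edges v|) l.+1.
  by move: lt_l; rewrite gtn_max => /andP[lt1 lt2]; rewrite !esym_at_geq.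
apply/eqP; rewrite -subr_eq0 -!eval_elem_sym -eval_atB; apply/eqP/e0.
by exists v, l.+1.
Qed.

Definition thin u := forall v,
  (#|nonzeros (out_edges v) (edge_coord u)| <= 1)%N /\
  (#|nonzeros (in_edges v) (edge_coord u)| <= 1)%N.

(** The generators with [l >= 2] express thinness. Thinness in turn makes both sides of [balanced]
    vanish for [l >= 2], so only the linear generator is left to give balance. *)
Lemma eval_strong_incidence_ideal u :
  (forall f, strong_incidence_ideal f -> eval_at u f = 0) <->
  balanced u /\ thin u.
Proof.
rewrite eval_ideal_gen; split=> [e0|[b thin_u] f [v [->|[l [le_l ->]]|[l [le_l ->]]]]].
- have th : thin u.
    move=> v; split; apply/card_nonzeros_le1 => l le_l;
      rewrite -eval_elem_sym; apply: e0; exists v.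
      by apply: Or32; exists l.
    by apply: Or33; exists l.
  split=> // v [|[|l]]; first by rewrite !esym_at0.
    apply/eqP; rewrite -subr_eq0 -!eval_elem_sym -eval_atB; apply/eqP/e0.
    by exists v; apply: Or31.
  have [th1 th2] := th v.
  rewrite [LHS]esym_nonzeros [RHS]esym_nonzeros !esym_at_geq //.
  - exact: leq_ltn_trans th2 _.
  - exact: leq_ltn_trans th1 _.
- by rewrite eval_atB !eval_elem_sym b subrr.
- by rewrite eval_elem_sym; apply: (card_nonzeros_le1 _ _).2 le_l; case: (thin_u v).
- by rewrite eval_elem_sym; apply: (card_nonzeros_le1 _ _).2 le_l; case: (thin_u v).
Qed.

Definition chi c : point := \row_i (enum_val i \in dicycle_edges c)%:R.

Definition cycle_span C : {vspace point} := (\sum_(c in C) <[chi c]>)%VS.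

Lemma edge_coord_chi c x : edge_coord (chi c) x = (x \in dicycle_edges c)%:R.
Proof. by rewrite /edge_coord mxE enum_rankK. Qed.

Lemma cycle_spanP C u : u \in cycle_span C ->
  exists a : {set cycle_seq G} -> F, u = \sum_(c in C) a c *: chi c.
Proof.
case/memv_sumP=> us us_c ->.
have /fin_all_exists[a a_c] (c : {set cycle_seq G}) :
    exists k, c \in C -> us c = k *: chi c.
  have [cC|] := boolP (c \in C); last by exists 0.
  by have /vlineP[k ->] := us_c c cC; exists k.
by exists a; apply: eq_bigr => c /a_c.
Qed.

Lemma edge_disjointP C : reflect
  (forall c d x, c \in C -> d \in C ->
     x \in dicycle_edges c -> x \in dicycle_edges d -> c = d) (edge_disjoint C).
Proof.
apply: (iffP forall_inP) => [dis c d x cC dC xc xd|dis c cC].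
  apply/eqP; apply: contraTT xd => ne; have /forall_inP/(_ d dC) := dis c cC.
  by rewrite ne => /pred0P/(_ x) /=; rewrite xc /= => ->.
apply/forall_inP => d dC; apply/implyP; apply: contraNT => /pred0Pn[x /andP[xc xd]].
by rewrite (dis c d x).
Qed.

Lemma vertex_disjointP C : reflect
  (forall c d v, c \in C -> d \in C ->
     v \in dicycle_vertices c -> v \in dicycle_vertices d -> c = d) (vertex_disjoint C).
Proof.
apply: (iffP forall_inP) => [dis c d x cC dC xc xd|dis c cC].
  apply/eqP; apply: contraTT xd => ne; have /forall_inP/(_ d dC) := dis c cC.
  by rewrite ne => /pred0P/(_ x) /=; rewrite xc /= => ->.
apply/forall_inP => d dC; apply/implyP; apply: contraNT => /pred0Pn[x /andP[xc xd]].
by rewrite (dis c d x).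
Qed.

Lemma edge_coord_sum C a x :
  edge_coord (\sum_(c in C) a c *: chi c) x =
  \sum_(c in C) a c * (x \in dicycle_edges c)%:R.
Proof.
rewrite /edge_coord summxE; apply: eq_bigr => c _.
by rewrite mxE -/(edge_coord _ _) edge_coord_chi.
Qed.

Lemma edge_coord_in C a c x : edge_disjoint C -> c \in C ->
  x \in dicycle_edges c -> edge_coord (\sum_(d in C) a d *: chi d) x = a c.
Proof.
move=> /edge_disjointP dis cC xc; rewrite edge_coord_sum (bigD1 c) //= xc mulr1.
rewrite big1 ?addr0 // => d /andP[dC ne].
have [xd|_] := boolP (x \in _); last by rewrite mulr0.
by rewrite (dis c d x) ?eqxx in ne.
Qed.

Lemma edge_coord_neq0 C a x :
  edge_coord (\sum_(d in C) a d *: chi d) x != 0 ->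
  exists2 c, c \in C & x \in dicycle_edges c.
Proof.
move=> nz; have [/exists_inP//|/exists_inPn no] :=
  boolP [exists c in C, x \in dicycle_edges c].
move: nz; rewrite edge_coord_sum big1 ?eqxx // => c cC.
by rewrite (negbTE (no c cC)) mulr0.
Qed.

(** By disjointness the coordinate at an edge is the coefficient of the only member through it, or 0
    if there is none. So the level set of [b] is the disjoint union of the members with coefficient
    [b], cut down to [A]. *)
Lemma card_level_sum C a A b : edge_disjoint C -> b != 0 ->
  #|level A (edge_coord (\sum_(d in C) a d *: chi d)) b| =
  (\sum_(c in C | a c == b) #|dicycle_edges c :&: A|)%N.
Proof.
move=> dis b0; set w := edge_coord _.
(* The sum has at most one nonzero term, so it is an indicator; this prepares the double counting by
   [exchange_big]. *)
have wx x : (w x == b) =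
    (\sum_(c in C | a c == b) (x \in dicycle_edges c) : nat)%N :> nat.
  have [/existsP[c /andP[cC xc]]|no] := boolP [exists c in C, x \in dicycle_edges c].
    rewrite /w (edge_coord_in _ dis cC xc).
    have z d : d \in C -> d != c -> (x \in dicycle_edges d) = 0%N :> nat.
      move=> dC ne; case: (boolP (x \in _)) => // xd.
      by rewrite (edge_disjointP _ dis c d x) ?eqxx in ne.
    case: (eqVneq (a c) b) => [e|ne].
      rewrite (bigD1 c) /= ?cC ?e ?eqxx // xc big1 // => d /andP[/andP[dC _]]; exact: z.
    rewrite big1 // => d /andP[dC /eqP e]; apply: z => //.
    by apply: contraNneq ne => <-; rewrite e.
  have /eqP-> : w x == 0.
    by apply: contraNT no => /edge_coord_neq0[c cC xc];
       apply/existsP; exists c; rewrite cC.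
  rewrite eq_sym (negbTE b0) big1 // => c /andP[cC _]; case: (boolP (x \in _)) => // xc.
  by case/existsP: no; exists c; rewrite cC.
rewrite -sum1_card; under eq_bigl do rewrite inE.
rewrite big_mkcondr /=.
under eq_bigr => x _ do rewrite -[if _ then _ else _]/(nat_of_bool _) wx.
rewrite exchange_big; apply: eq_bigr => c _ /=.
rewrite -sum1_card; under [RHS]eq_bigl do rewrite inE andbC.
by rewrite [RHS]big_mkcondr; apply: eq_bigr => x _; case: (_ \in _).
Qed.

(** A cycle has as many edges leaving [v] as entering it, and level sets are unions of members of
    [C]. *)
Lemma balanced_cycle_span C u : C \subset dicycles G -> edge_disjoint C ->
  u \in cycle_span C -> balanced u.
Proof.
move=> /subsetP Cd dis /cycle_spanP[a ->]; apply/balancedP => v b b0.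
rewrite !card_level_sum //; apply: eq_bigr => c /andP[/Cd cd _].
by rewrite dicycle_out_degree ?dicycle_in_degree.
Qed.

End Balanced.

(** * Decomposition into cycles *)

Section Decomposition.
Variables (F : fieldType) (G : digraph).
Local Notation point := 'rV[F]_#|edge G|.
Implicit Types (u : point) (A : {set edge G}) (v : vertex G).
Implicit Types (c d : {set cycle_seq G}) (C : {set {set cycle_seq G}}).

Lemma cycle_span_sub C1 C2 : C1 \subset C2 -> (cycle_span F C1 <= cycle_span F C2)%VS.
Proof.
move=> /subsetP sub; apply/subv_sumP => c cC; exact: (sumv_sup c (sub c cC)).
Qed.

Lemma mem_cycle_span C c : c \in C -> chi F c \in cycle_span F C.
Proof. by move=> cC; rewrite memvE; apply: (sumv_sup c). Qed.

Lemma chi_neq0 c : c \in dicycles G -> chi F c != 0.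
Proof.
move=> /dicycle_edges_neq0/set0Pn[x xc]; apply: contraTneq (oner_neq0 F) => c0.
by rewrite -[1]/(true%:R) -xc -(edge_coord_chi F c x) c0 /edge_coord mxE negbK.
Qed.

(** A combination of disjoint cycles is constant on each member. On a member [d] that meets [c] this
    constant is 1, so [d] lies inside [c], and nested cycles are equal. *)
Lemma mem_chi_cycle_span C c : c \in dicycles G -> C \subset dicycles G ->
  edge_disjoint C -> chi F c \in cycle_span F C -> c \in C.
Proof.
move=> cd /subsetP Cd dis /cycle_spanP[a ea].
have /set0Pn[x xc] := dicycle_edges_neq0 cd.
have xc1 : edge_coord (chi F c) x = 1 by rewrite edge_coord_chi xc.
have [d dC xd] : exists2 d, d \in C & x \in dicycle_edges d.
  by apply: (edge_coord_neq0 (a := a)); rewrite -ea xc1 oner_neq0.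
suff <- : d = c by [].
apply: dicycle_edges_sub => //; first exact: Cd.
apply/subsetP => y yd; have : edge_coord (chi F c) y = 1.
  by rewrite ea (edge_coord_in _ dis dC yd) -(edge_coord_in a dis dC xd) -ea.
rewrite edge_coord_chi; case: (y \in _) => // /esym/eqP.
by rewrite oner_eq0.
Qed.

Definition supp u : {set edge G} := [set x | edge_coord u x != 0].

(** Among the edges with the value of [x], balance at the terminal vertex of each one yields an
    outgoing edge with that value, so [exists_dicycle_in] applies. *)
Lemma balanced_constant_cycle u x : balanced u -> x \in supp u ->
  exists2 c, c \in dicycles G &
    {in dicycle_edges c, forall y, edge_coord u y = edge_coord u x}.
Proof.
rewrite inE => /balancedP b x0; pose A := [set y | edge_coord u y == edge_coord u x].
have [||c cd /subsetP cA] := @exists_dicycle_in G A.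
- by apply/set0Pn; exists x; rewrite inE.
- move=> y; rewrite inE => /eqP yx; have := b (tgt y) _ x0.
  have : (0 < #|level (in_edges (tgt y)) (edge_coord u) (edge_coord u x)|)%N.
    by apply/card_gt0P; exists y; rewrite !inE yx !eqxx.
  move=> /[swap] <- /card_gt0P[z]; rewrite !inE => /andP[/eqP zy zx].
  by exists z; rewrite // inE.
by exists c => // y /cA; rewrite inE => /eqP.
Qed.

(** The subtraction sets the coordinates on [c] to 0 and leaves the others alone. The level set of
    [b] thus loses the edges of [c] when [a = b] and nothing otherwise, so the truncated difference
    is exact. *)
Lemma card_level_subchi u c (a b : F) A : b != 0 ->
  {in dicycle_edges c, forall y, edge_coord u y = a} ->
  #|level A (edge_coord (u - a *: chi F c)) b| =
  (#|level A (edge_coord u) b| - (a == b) * #|dicycle_edges c :&: A|)%N.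
Proof.
move=> b0 ca; have coord y : edge_coord (u - a *: chi F c) y =
    if y \in dicycle_edges c then 0 else edge_coord u y.
  rewrite {1}/edge_coord !mxE -/(edge_coord u y) enum_rankK.
  by case: ifP => [/ca->|_]; rewrite ?mulr1n ?mulr1 ?mulr0n ?mulr0 ?subrr ?subr0.
set E := dicycle_edges c in ca coord *; clearbody E.
have -> : level A (edge_coord (u - a *: chi F c)) b =
    level A (edge_coord u) b :\: E.
  apply/setP => y; rewrite !inE coord; case: ifP => //= _.
  by rewrite eq_sym (negbTE b0) andbF.
rewrite cardsD; congr (_ - _)%N; have [<-|ne] := eqVneq a b.
  rewrite mul1n; apply: eq_card => y; rewrite !inE.
  by have [/ca->|_] := boolP (y \in E); rewrite ?eqxx ?andbT ?andbF.
apply/eqP; rewrite mul0n cards_eq0; apply/set0Pn => -[y]; rewrite !inE.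
by case/andP=> /andP[_ /eqP yb] /ca ya; rewrite -ya yb eqxx in ne.
Qed.

(* A level set of a nonzero value is an Eulerian subgraph, so it contains a
   cycle, and subtracting the corresponding multiple of its indicator vector
   preserves balance and shrinks the support. *)
Lemma balanced_decomposition u : balanced u ->
  exists C, [/\ C \subset dicycles G, edge_disjoint C,
    {in C, forall c, dicycle_edges c \subset supp u} & u \in cycle_span F C].
Proof.
have [n] := ubnP #|supp u|; elim: n u => // n IH u lt_un b.
have [u0|/set0Pn[x xu]] := eqVneq (supp u) set0.
  exists set0; split; first exact: sub0set.
  - by apply/edge_disjointP => c d x; rewrite inE.
  - by move=> c; rewrite inE.
  suff -> : u = 0 by rewrite mem0v.
  apply/rowP => i; rewrite mxE -(enum_valK i); apply/eqP.
  by move/setP/(_ (enum_val i)): u0; rewrite !inE => /negbFE.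
have [c cd cx] := balanced_constant_cycle b xu.
set a := edge_coord u x in cx; pose u' := u - a *: chi F c.
have a0 : a != 0 by move: xu; rewrite inE.
have b' : balanced u'.
  apply/balancedP => v k k0; rewrite !(card_level_subchi _ k0 cx).
  by rewrite (balancedP u).1 // dicycle_out_degree ?dicycle_in_degree.
have cu : dicycle_edges c \subset supp u.
  by apply/subsetP => y /cx ya; rewrite inE ya.
have su' : supp u' = supp u :\: dicycle_edges c.
  apply/setP => y; rewrite in_setD !(in_set (fun x => edge_coord _ x != 0)).
  rewrite {1}/edge_coord !mxE -/(edge_coord u y) enum_rankK.
  by have [/cx->|_] := boolP (y \in _);
     rewrite ?mulr1n ?mulr1 ?mulr0n ?mulr0 ?subrr ?subr0 ?eqxx.
have /IH/(_ b')[C [Cd dis Cu u'C]] : (#|supp u'| < n)%N.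
  rewrite -ltnS; apply: leq_trans lt_un; rewrite ltnS su' cardsD (setIidPr cu).
  rewrite ltn_subrL; apply/andP; split; first by rewrite card_gt0 dicycle_edges_neq0.
  by apply/card_gt0P; exists x.
(* The support clause of the induction hypothesis is what keeps the new cycle [c] disjoint from the
   members of [C]. *)
have cC d y : d \in C -> y \in dicycle_edges d -> y \notin dicycle_edges c.
  by move=> dC /(subsetP (Cu d dC)); rewrite su' in_setD => /andP[].
exists (c |: C); split.
- by rewrite subUset sub1set cd.
- apply/edge_disjointP => d e y; rewrite !in_setU1.
  move=> /predU1P[->|dC] /predU1P[->|eC] yd ye //.
  + by have := cC _ _ eC ye; rewrite yd.
  + by have := cC _ _ dC yd; rewrite ye.
  + exact: (edge_disjointP _ dis d e y).
- move=> d; rewrite in_setU1 => /predU1P[->//|/Cu/subset_trans]; apply.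
  by rewrite su' subsetDl.
rewrite -[u](subrK (a *: chi F c)) -/u'; apply: memvD.
  exact: (subvP (cycle_span_sub (subsetUr _ _))) u'C.
by apply/memvZ/mem_cycle_span; rewrite in_setU1 eqxx.
Qed.

(** At most one member passes through [v], and it has one edge in [S v]. The parameter [S] stands
    for [out_edges] or [in_edges]. *)
Lemma cycle_span_thin (S : vertex G -> {set edge G}) C a v :
  (forall c, c \in C -> #|dicycle_edges c :&: S v| = (v \in dicycle_vertices c)) ->
  vertex_disjoint C ->
  (#|nonzeros (S v) (edge_coord (\sum_(c in C) a c *: chi F c))| <= 1)%N.
Proof.
move=> deg /vertex_disjointP dis; apply/card_le1_eqP => x y.
rewrite !inE => /andP[xS /edge_coord_neq0[c cC xc]] /andP[yS /edge_coord_neq0[d dC yd]].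
have vert e z : e \in C -> z \in S v -> z \in dicycle_edges e -> v \in dicycle_vertices e.
  move=> eC zS ze; have : (0 < #|dicycle_edges e :&: S v|)%N.
    by apply/card_gt0P; exists z; rewrite in_setI ze.
  by rewrite deg // lt0b.
have ecd := dis c d v cC dC (vert _ _ cC xS xc) (vert _ _ dC yS yd); subst d.
have /card_le1_eqP : (#|dicycle_edges c :&: S v| <= 1)%N by rewrite deg // leq_b1.
by apply; rewrite in_setI ?xc ?yd.
Qed.

(** A common edge gives a common vertex, its source. *)
Lemma vertex_disjoint_edge C : C \subset dicycles G ->
  vertex_disjoint C -> edge_disjoint C.
Proof.
move=> /subsetP Cd /vertex_disjointP dis; apply/edge_disjointP => c d x cC dC xc xd.
have vert e : e \in C -> x \in dicycle_edges e -> src x \in dicycle_vertices e.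
  move=> eC xe; have : (0 < #|dicycle_edges e :&: out_edges (src x)|)%N.
    by apply/card_gt0P; exists x; rewrite in_setI xe inE eqxx.
  by rewrite dicycle_out_degree ?Cd // lt0b.
exact: dis (vert _ cC xc) (vert _ dC xd).
Qed.

Lemma balanced_cycles u : balanced u <->
  exists C, [/\ C \subset dicycles G, edge_disjoint C & u \in cycle_span F C].
Proof.
split=> [/balanced_decomposition[C [Cd dis _ uC]]|[C [Cd dis uC]]].
  by exists C.
exact: balanced_cycle_span uC.
Qed.

(** Two members of the decomposition through [v] both have an outgoing edge at [v] in the support of
    [u]. Thinness identifies these edges, and edge-disjointness then identifies the cycles. *)
Lemma thin_cycles u : balanced u /\ thin u <->
  exists C, [/\ C \subset dicycles G, vertex_disjoint C & u \in cycle_span F C].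
Proof.
split=> [[/balanced_decomposition[C [Cd dis Cu uC]] th]|[C [Cd dis uC]]]; last first.
  split; first exact: balanced_cycle_span (vertex_disjoint_edge Cd dis) uC.
  have [a ->] := cycle_spanP uC; move=> v; move/subsetP: Cd => Cd.
  split; [apply: (@cycle_span_thin (@out_edges G))
         |apply: (@cycle_span_thin (@in_edges G))];
    move=> // c /Cd cd; [exact: dicycle_out_degree | exact: dicycle_in_degree].
exists C; split=> //; apply/vertex_disjointP => c d v cC dC vc vd.
have [x] : exists x, x \in dicycle_edges c :&: out_edges v.
  by apply/card_gt0P; rewrite dicycle_out_degree ?(subsetP Cd) // vc.
have [y] : exists y, y \in dicycle_edges d :&: out_edges v.
  by apply/card_gt0P; rewrite dicycle_out_degree ?(subsetP Cd) // vd.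
rewrite !in_setI => /andP[yd yv] /andP[xc xv].
have [/card_le1_eqP le1 _] := th v.
have nz e z : e \in C -> z \in dicycle_edges e -> z \in out_edges v ->
    z \in nonzeros (out_edges v) (edge_coord u).
  by move=> eC ze zv; rewrite inE zv; have := subsetP (Cu e eC) z ze; rewrite inE.
have exy := le1 _ _ (nz _ _ cC xc xv) (nz _ _ dC yd yv).
by apply: (edge_disjointP _ dis c d x); rewrite // -exy.
Qed.

End Decomposition.

(** * Linear subspaces and irreducibility *)

Section ProjectiveGeometry.
Variables (F : numFieldType) (n : nat).
Local Notation point := 'rV[F]_n.
Implicit Types (u p q : point) (f g : {mpoly F[n]}) (L : proj_space F n).
Implicit Types (W : {vspace point}) (X : set (proj_space F n)).

Lemma proj_space_line L : exists2 u, u != 0 & val L = <[u]>%VS.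
Proof.
case: L => /= V dimV; exists (vpick V); first by rewrite vpick0 -dimv_eq0 (eqP dimV).
apply/eqP; rewrite eq_sym eqEdim -memvE memv_pick (eqP dimV) dim_vline.
by rewrite vpick0 -dimv_eq0 (eqP dimV).
Qed.

Lemma line_proj_space u : u != 0 -> exists L, val L = <[u]>%VS.
Proof.
move=> u0; have dimu : \dim <[u]> == 1%N by rewrite dim_vline u0.
by exists (exist _ <[u]>%VS dimu).
Qed.

Lemma homog_evalZ f d u k : f \is d.-homog ->
  f.@[fun i => (k *: u) 0 i] = k ^+ d * f.@[fun i => u 0 i].
Proof.
move=> /dhomogP fd; rewrite !mevalE mulr_sumr big_seq [RHS]big_seq.
apply: eq_bigr => m mf; have <- : mdeg m = d := fd m mf.
rewrite mulrCA; congr (_ * _).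
rewrite mdegE -prodrXr -big_split /=.
by apply: eq_bigr => i _; rewrite mxE exprMn.
Qed.

Lemma homog_vanishes_at f d L u : f \is d.-homog -> u \in val L -> u != 0 ->
  f.@[fun i => u 0 i] = 0 -> vanishes_at f L.
Proof.
move=> fd uL u0 fu p pL _; have [w w0 Lw] := proj_space_line L.
move: uL pL; rewrite !Lw => /vlineP[k uk] /vlineP[l ->].
have k0 : k != 0 by apply: contraNneq u0 => k0; rewrite uk k0 scale0r.
have -> : l *: w = (l / k) *: u by rewrite uk scalerA divfK.
by rewrite (homog_evalZ _ _ fd) fu mulr0.
Qed.

(** A linear map with kernel [W]; its coordinates serve as equations of [W]. *)
Definition residual W : point -> point := fun u => u - projv W u.

Definition linear_form W (i : 'I_n) : {mpoly F[n]} :=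
  \sum_j (residual W (delta_mx 0 j)) 0 i *: 'X_j.

Lemma linear_form_homog W i : linear_form W i \is 1.-homog.
Proof.
by apply: rpred_sum => j _; apply: rpredZ; rewrite dhomogX /= mdeg1.
Qed.

Lemma eval_linear_form W i u :
  (linear_form W i).@[fun i => u 0 i] = residual W u 0 i.
Proof.
rewrite raddf_sum /= {2}(row_sum_delta u) /residual linear_sum -sumrB summxE.
by apply: eq_bigr => j _; rewrite mevalZ mevalXU linearZ -scalerBr [RHS]mxE mulrC.
Qed.

Lemma linear_formP W u :
  (forall i, (linear_form W i).@[fun i => u 0 i] = 0) <-> u \in W.
Proof.
split=> [u0|uW i]; last by rewrite eval_linear_form /residual projv_id // subrr mxE.
suff -> : u = projv W u by exact: memv_proj.
apply/eqP; rewrite -subr_eq0; apply/eqP/rowP => i.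
by have := u0 i; rewrite eval_linear_form => e; rewrite [RHS]mxE.
Qed.

Lemma linear_formPn W u : u \notin W ->
  exists i, (linear_form W i).@[fun i => u 0 i] != 0.
Proof.
move=> uW; apply/existsP; apply: contraNT uW => /existsPn no.
by apply/linear_formP => i; apply/eqP/negbNE/no.
Qed.

Lemma linear_subspace_algebraic X : linear_subspace X -> algebraic_set X.
Proof.
case=> W ->; exists (fun f => exists i, f = linear_form W i); split.
  by move=> _ [i ->]; exists 1%N; apply: linear_form_homog.
apply/seteqP; split=> L /=.
  move=> LW _ [i ->] u uL _; apply: (linear_formP _ _).2.
  exact: subvP uL.
move=> van; have [u u0 Lu] := proj_space_line L; rewrite Lu -memvE.
by apply/linear_formP => i; apply: (van _ (ex_intro _ i erefl)) u0; rewrite Lu memv_line.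
Qed.

(** In characteristic 0 the first [size p] natural numbers are distinct, too many for all to be
    roots. *)
Lemma poly_nat_nonroot (p : {poly F}) : p != 0 -> exists k : nat, p.[k%:R] != 0.
Proof.
move=> p0; apply: boolp.contrapT => no.
have : (size [seq k%:R : F | k <- iota 0 (size p)] < size p)%N.
  apply: max_poly_roots => //.
    apply/allP => _ /mapP[k _ ->]; apply/negbNE/negP => nk.
    by apply: no; exists k.
  by rewrite map_inj_uniq ?iota_uniq // => i j /eqP; rewrite eqr_nat => /eqP.
by rewrite size_map size_iota ltnn.
Qed.

Definition line_point p q (t : F) : point := p + t *: (q - p).

Definition on_line p q f : {poly F} :=
  mmap polyC (fun i => (p 0 i)%:P + 'X * ((q - p) 0 i)%:P) f.

Lemma horner_on_line p q f t :
  (on_line p q f).[t] = f.@[fun i => line_point p q t 0 i].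
Proof.
rewrite /on_line mevalE /mmap horner_sum; apply: eq_bigr => m _.
rewrite hornerM hornerC /mmap1 horner_prod; congr (_ * _).
by apply: eq_bigr => i _; rewrite horner_exp !hornerE !mxE.
Qed.

(* The point is found on the line through p and q, where the restrictions of f,
   g and a coordinate are nonzero polynomials in one variable. *)
Lemma linear_subspace_common_nonzero W f g p q : p != 0 -> p \in W -> q \in W ->
  f.@[fun i => p 0 i] != 0 -> g.@[fun i => q 0 i] != 0 ->
  exists u, [/\ u \in W, u != 0,
    f.@[fun i => u 0 i] != 0 & g.@[fun i => u 0 i] != 0].
Proof.
move=> p0 pW qW fp gq; have /existsP[i pi] : [exists i, p 0 i != 0].
  apply: contraNT p0 => /existsPn no; apply/eqP/rowP => i; rewrite mxE.
  by apply/eqP/negbNE/no.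
have at0 : line_point p q 0 = p by rewrite /line_point scale0r addr0.
have at1 : line_point p q 1 = q by rewrite /line_point scale1r addrC subrK.
have nz h t : h.@[fun i => line_point p q t 0 i] != 0 -> on_line p q h != 0.
  by move=> ht; apply: contraNneq ht => h0; rewrite -horner_on_line h0 horner0.
have [|k] := @poly_nat_nonroot (on_line p q f * on_line p q g * on_line p q 'X_i).
  rewrite !mulf_neq0 //.
  - by apply: (nz _ 0); rewrite at0.
  - by apply: (nz _ 1); rewrite at1.
  - by apply: (nz _ 0); rewrite at0 mevalXU.
rewrite !hornerM !mulf_eq0 !negb_or !horner_on_line mevalXU => /andP[/andP[fk gk] ik].
exists (line_point p q k%:R); split=> //.
  by rewrite memvD // memvZ // memvB.
by apply: contraNneq ik => ->; rewrite mxE.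
Qed.

Lemma not_zero_locus (S : set {mpoly F[n]}) L : ~ zero_locus S L ->
  exists f u, [/\ S f, u \in val L, u != 0 & f.@[fun i => u 0 i] != 0].
Proof.
move=> nL; apply: boolp.contrapT => no; apply: nL => f Sf u uL u0.
by apply/eqP/negbNE/negP => fu; apply: no; exists f, u.
Qed.

(** If neither part contained [X], an equation of each would be nonzero somewhere on [W]. A vector
    of [W] where both are nonzero spans a point of [X] outside the union. *)
Lemma linear_subspace_variety X : linear_subspace X -> projective_variety X.
Proof.
move=> linX; split; first exact: linear_subspace_algebraic.
case: linX => W eX _ _ [S [_ ->]] [T [_ ->]] eST.
case: (boolp.EM (forall L, X L -> zero_locus S L)) => [XS|nXS].
  by left; apply/seteqP; split=> // L SL; rewrite eST; left.
case: (boolp.EM (forall L, X L -> zero_locus T L)) => [XT|nXT].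
  by right; apply/seteqP; split=> // L TL; rewrite eST; right.
have [L1 [XL1 /not_zero_locus[f [p [Sf pL p0 fp]]]]] : exists L, X L /\ ~ zero_locus S L.
  apply: boolp.contrapT => no; apply: nXS => L XL; apply: boolp.contrapT => nL.
  by apply: no; exists L.
have [L2 [XL2 /not_zero_locus[g [q [Tg qL q0 gq]]]]] : exists L, X L /\ ~ zero_locus T L.
  apply: boolp.contrapT => no; apply: nXT => L XL; apply: boolp.contrapT => nL.
  by apply: no; exists L.
rewrite eX in XL1 XL2.
have [u [uW u0 fu gu]] :=
  linear_subspace_common_nonzero p0 (subvP XL1 _ pL) (subvP XL2 _ qL) fp gq.
have [L Lu] := line_proj_space u0.
have : X L by rewrite eX /= Lu -memvE.
have uL : u \in val L by rewrite Lu memv_line.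
rewrite eST => -[/(_ f Sf u uL u0)/eqP|/(_ g Tg u uL u0)/eqP].
  by rewrite (negbTE fu).
by rewrite (negbTE gu).
Qed.

(** Adding [f], respectively [g], to the equations of [X] gives two algebraic sets that cover [X],
    since at each point one factor vanishes. Homogeneity carries this from one vector to the whole
    line. *)
Lemma variety_prime X f g d e :
  projective_variety X -> f \is d.-homog -> g \is e.-homog ->
  (forall L, X L -> vanishes_at (f * g) L) ->
  (forall L, X L -> vanishes_at f L) \/ (forall L, X L -> vanishes_at g L).
Proof.
move=> [[S [homS ->]] irr] fd ge van.
have alg h k : h \is k.-homog -> algebraic_set (zero_locus (fun x => S x \/ x = h)).
  by move=> hk; eexists; split; last by []; move=> x [/homS|->] //; exists k.
have := irr _ _ (alg f d fd) (alg g e ge); case.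
- apply/seteqP; split=> L; last by case=> SL x Sx; apply: SL; left.
  move=> SL; have [u u0 Lu] := proj_space_line L.
  have uL : u \in val L by rewrite Lu memv_line.
  have /eqP := van L SL u uL u0; rewrite mevalM mulf_eq0 => /orP[/eqP|/eqP] z.
    by left=> x [/SL//|->]; apply: homog_vanishes_at fd uL u0 z.
  by right=> x [/SL//|->]; apply: homog_vanishes_at ge uL u0 z.
- by move=> -> ; left=> L; apply; right.
- by move=> -> ; right=> L; apply; right.
Qed.

(* In the induction, h is a product of linear forms, one vanishing on each of the
   subspaces already discarded. *)
Lemma variety_cover X (Ws : seq {vspace point}) h d :
  projective_variety X -> h \is d.-homog ->
  (forall L, X L -> vanishes_at h L \/ exists2 W, W \in Ws & (val L <= W)%VS) ->
  (forall L, X L -> vanishes_at h L) \/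
  exists2 W, W \in Ws & forall L, X L -> (val L <= W)%VS.
Proof.
move=> varX; elim: Ws h d => [|W Ws IH] h d hd cov.
  by left=> L /cov[//|[W]].
case: (boolp.EM (forall L, X L -> (val L <= W)%VS)) => [XW|nXW].
  by right; exists W => //; rewrite mem_head.
have [L [XL nL]] : exists L, X L /\ ~ (val L <= W)%VS.
  apply: boolp.contrapT => no; apply: nXW => L XL; apply: boolp.contrapT => nL.
  by apply: no; exists L.
have [u u0 Lu] := proj_space_line L.
have [i ui] : exists i, (linear_form W i).@[fun i => u 0 i] != 0.
  by apply: linear_formPn; apply/negP; rewrite memvE -Lu.
have hid := dhomogM hd (linear_form_homog W i).
have [L' XL'|van|[W' W'Ws XW']] := IH _ _ hid.
- case: (cov L' XL') => [hL'|[W' + LW']].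
    by left=> v vL v0; rewrite mevalM hL' ?mul0r.
  rewrite inE => /predU1P[eW|]; last by right; exists W'.
  left=> v vL _; rewrite mevalM (linear_formP W v).2 ?mulr0 //.
  by rewrite -eW; apply: subvP vL.
- have [|vi] := variety_prime varX hd (linear_form_homog W i) van; first by left.
  have := vi L XL u _ u0; rewrite Lu memv_line => /(_ isT)/eqP.
  by rewrite (negbTE ui).
- by right; exists W' => //; rewrite inE W'Ws orbT.
Qed.

(** This is [variety_cover] started at [h = 1]. If 1 vanishes on [X] then [X] is empty and any
    member of [Ws] will do. *)
Lemma variety_union_linear X (Ws : seq {vspace point}) : Ws != [::] ->
  projective_variety X ->
  (forall L, X L -> exists2 W, W \in Ws & (val L <= W)%VS) ->
  exists2 W, W \in Ws & forall L, X L -> (val L <= W)%VS.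
Proof.
case: Ws => // W Ws _ varX cov.
have hom1 : (1 : {mpoly F[n]}) \is 0.-homog by apply: dhomog1.
have [L /cov|van1|//] := variety_cover (Ws := W :: Ws) varX hom1; first by right.
exists W; first exact: mem_head.
move=> L XL; have [u u0 Lu] := proj_space_line L.
have := van1 L XL u _ u0; rewrite Lu memv_line => /(_ isT)/eqP.
by rewrite meval1 oner_eq0.
Qed.

End ProjectiveGeometry.

(** * Unions of spans of disjoint families *)

Section CycleVarieties.
Variables (F : numFieldType) (G : digraph).
Implicit Types (c : {set cycle_seq G}) (C : {set {set cycle_seq G}}).
(** [P] stands for edge-disjointness or vertex-disjointness, so that one argument serves both
    varieties. *)
Variable P : pred {set {set cycle_seq G}}.
Hypothesis P0 : P set0.
Hypothesis P1 : forall c, c \in dicycles G -> P [set c].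
Hypothesis P_edge_disjoint : forall C, C \subset dicycles G -> P C -> edge_disjoint C.
Variable X : set (proj_space F #|edge G|).
Hypothesis XP : forall L, X L <->
  exists C, [/\ C \subset dicycles G, P C & (val L <= cycle_span F C)%VS].

(** Irreducibility puts [X] inside the span of one admissible [C]. Each cycle [c] gives a point of
    [X] through the family [[set c]], so [c] belongs to [C]. *)
Lemma cycle_variety_family : projective_variety X -> P (dicycles G).
Proof.
move=> varX.
pose Cs := [seq C : {set {set cycle_seq G}} <- enum {set {set cycle_seq G}} |
             (C \subset dicycles G) && P C].
have [|L /XP[C [Cd PC LC]]|W /mapP[C + ->] XC] :=
    @variety_union_linear _ _ X [seq cycle_span F C | C <- Cs] _ varX.
- have : set0 \in Cs by rewrite mem_filter sub0set P0 mem_enum.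
  by case: Cs.
- by exists (cycle_span F C) => //; apply: map_f; rewrite mem_filter Cd PC mem_enum.
rewrite mem_filter => /andP[/andP[Cd PC] _].
suff /eqP <- : C == dicycles G by [].
rewrite eqEsubset Cd; apply/subsetP => c cd.
have [L Lc] := line_proj_space (chi_neq0 F cd).
apply: (mem_chi_cycle_span (F := F)) => //; first exact: P_edge_disjoint.
rewrite memvE -Lc; apply: XC; apply/XP; exists [set c]; rewrite sub1set P1 //.
by split=> //; rewrite Lc -memvE mem_cycle_span // set11.
Qed.

(** Spans grow with the family, so the span of all cycles absorbs the others. *)
Lemma family_cycle_variety : P (dicycles G) ->
  X = [set L | (val L <= cycle_span F (dicycles G))%VS]%classic.
Proof.
move=> Pd; apply/seteqP; split=> L.
  by case/XP=> C [Cd _ LC]; apply: subv_trans LC (cycle_span_sub F Cd).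
by move=> LX; apply/XP; exists (dicycles G).
Qed.

(** The maximum is attained, as the empty family is admissible, and a subfamily with as many members
    as the whole is the whole. *)
Lemma family_maxcard : P (dicycles G) <->
  #|dicycles G| =
     (\max_(C : {set {set cycle_seq G}} | (C \subset dicycles G) && P C) #|C|)%N.
Proof.
split=> [Pd|cardd].
  apply/eqP; rewrite eqn_leq; apply/andP; split.
    by apply: (@leq_bigmax_cond _ _ (fun C : {set _} => #|C|)); rewrite subxx Pd.
  by apply/bigmax_leqP => C /andP[/subset_leq_card].
have [|C /andP[Cd PC] eC] := @eq_bigmax_cond _
    (fun C : {set {set cycle_seq G}} => (C \subset dicycles G) && P C) (fun C => #|C|).
  by apply/card_gt0P; exists set0; rewrite unfold_in sub0set P0.
suff /eqP <- : C == dicycles G by [].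
by rewrite eqEcard Cd cardd eC leqnn.
Qed.

Lemma cycle_variety_equivalences :
  (projective_variety X <-> linear_subspace X) /\
  (linear_subspace X <->
   #|dicycles G| =
     (\max_(C : {set {set cycle_seq G}} | (C \subset dicycles G) && P C) #|C|)%N).
Proof.
have lin : P (dicycles G) -> linear_subspace X.
  by move=> /family_cycle_variety ->; exists (cycle_span F (dicycles G)).
have var := @linear_subspace_variety _ _ X.
rewrite -family_maxcard; split; split=> //.
- by move/cycle_variety_family/lin.
- by move/var/cycle_variety_family.
Qed.

End CycleVarieties.

(** * Points of the two incidence varieties, and the theorem *)

Lemma int_zero_locusP (R : realType) (G : digraph) (I : set (edge_poly G))
    (L : proj_space R[i] #|edge G|) :
  int_zero_locus I L <->
  (forall u, u \in val L -> u != 0 -> forall f, I f -> eval_at u f = 0).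
Proof.
split=> [van u uL u0 f If|e0 _ [f If <-] u uL u0]; last exact: e0.
by apply: (van _ _ u uL u0); exists f.
Qed.

Lemma incidence_varietyP (R : realType) (G : digraph) (L : proj_space R[i] #|edge G|) :
  incidence_variety R G L <->
  exists C : {set {set cycle_seq G}}, [/\ C \subset dicycles G, edge_disjoint C &
                (val L <= cycle_span R[i] C)%VS].
Proof.
rewrite /incidence_variety int_zero_locusP; have [u u0 Lu] := proj_space_line L.
split=> [e0|[C [Cd dis /subvP LC]] v vL _]; last first.
  by apply/eval_incidence_ideal/balanced_cycles; exists C; rewrite LC.
have := e0 u _ u0; rewrite Lu memv_line => /(_ isT).
by move/eval_incidence_ideal/balanced_cycles=> [C [Cd dis uC]]; exists C.
Qed.

Lemma strong_incidence_varietyP (R : realType) (G : digraph)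
    (L : proj_space R[i] #|edge G|) :
  strong_incidence_variety R G L <->
  exists C : {set {set cycle_seq G}}, [/\ C \subset dicycles G, vertex_disjoint C &
                (val L <= cycle_span R[i] C)%VS].
Proof.
rewrite /strong_incidence_variety int_zero_locusP; have [u u0 Lu] := proj_space_line L.
split=> [e0|[C [Cd dis /subvP LC]] v vL _]; last first.
  by apply/eval_strong_incidence_ideal/thin_cycles; exists C; rewrite LC.
have := e0 u _ u0; rewrite Lu memv_line => /(_ isT).
by move/eval_strong_incidence_ideal/thin_cycles=> [C [Cd dis uC]]; exists C.
Qed.

Theorem theorem1p6 (R : realType) (G : digraph) :
  ((projective_variety (incidence_variety R G) <->
      linear_subspace (incidence_variety R G)) /\
   (linear_subspace (incidence_variety R G) <->
      #|dicycles G| = alpha G)) /\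
  ((projective_variety (strong_incidence_variety R G) <->
      linear_subspace (strong_incidence_variety R G)) /\
   (linear_subspace (strong_incidence_variety R G) <->
      #|dicycles G| = alpha_strong G)) /\
  (projective_variety (strong_incidence_variety R G) ->
     incidence_variety R G = strong_incidence_variety R G).
Proof.
have e0 : edge_disjoint (set0 : {set {set cycle_seq G}}).
  by apply/edge_disjointP => c d x; rewrite inE.
have e1 (c : {set cycle_seq G}) : edge_disjoint [set c].
  by apply/edge_disjointP => d e x; rewrite !in_set1 => /eqP-> /eqP->.
have v0 : vertex_disjoint (set0 : {set {set cycle_seq G}}).
  by apply/vertex_disjointP => c d x; rewrite inE.
have v1 (c : {set cycle_seq G}) : vertex_disjoint [set c].
  by apply/vertex_disjointP => d e x; rewrite !in_set1 => /eqP-> /eqP->.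
have eP := @incidence_varietyP R G.
have vP := @strong_incidence_varietyP R G.
split; first exact: (cycle_variety_equivalences e0 (fun c _ => e1 c) (fun C _ => id) eP).
split; first exact: (cycle_variety_equivalences v0 (fun c _ => v1 c)
  (@vertex_disjoint_edge G) vP).
move=> varS.
(* All cycles are vertex-disjoint, hence edge-disjoint, so both varieties equal the span of all
   cycles. *)
have vd := cycle_variety_family v0 (fun c _ => v1 c) (@vertex_disjoint_edge G) vP varS.
rewrite (family_cycle_variety vP vd); apply: (family_cycle_variety eP).
exact: vertex_disjoint_edge.
Qed.
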